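(* As $n\to\infty$, $\gamma(\Theta_{n,3})\sim\alpha(\Theta_{n,3})$. As $t\to\infty$, $\beta(\Theta_{2,t})=o(\gamma(\Theta_{2,t}))$.
   Context: $\Theta_{n,t}$ is the graph consisting of two vertices $u,v$ joined by $t$ internally vertex-disjoint $u$–$v$ paths, each of length $n$. For a connected loopless graph $G$ with $p$ vertices and $q$ edges, $\alpha(G)$ is its number of acyclic orientations and $\deg v$ the degree of vertex $v$; $$\beta(G)=\prod_{v\in V(G)}(\deg v+1)\prod_{uw\in E(G)}\exp\frac{-1}{2(\deg u+1)(\deg w+1)}.$$ Fix a spanning tree $T$ of $G$ with non-tree edges $e_1,\dots,e_k$ ($k=q-p+1$), let $C_i$ be the edge set of the unique cycle in $T+e_i$, and let $x_1,\dots,x_k$ be variables. For a monomial $m$, let $L_d(m)$ be the set of monomials of total degree $d$ dividing $m$, and $l_d(G)=|L_d(x_1^{|C_1|-2}\cdots x_k^{|C_k|-2})|$. Define $\gamma(G)=\sum_{d=0}^{p-1}l_d(G)2^{p-d-1}$. (For the graphs $\Theta_{n,3}$ and $\Theta_{2,t}$ every fundamental circuit has length $2n$, resp. $4$, for every choice of spanning tree, so $\gamma$ is well defined.) $f\sim g$ means $f/g\to1$, and $f=o(g)$ means $f/g\to0$. *)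

(* Defs.v *)
From HB Require Import structures.
From mathcomp Require Import all_boot all_order all_algebra.
From mathcomp Require Import (canonicals, coercions) mpoly.
From mathcomp Require Import boolp classical_sets reals topology normedtype.
From mathcomp Require Import sequences exp.

Set Implicit Arguments.
Unset Strict Implicit.
Unset Printing Implicit Defensive.

Import Order.TTheory GRing.Theory Num.Theory.
Import numFieldNormedType.Exports.

Local Open Scope ring_scope.

(* Finite loopless multigraphs: parallel edges are allowed.  The direction from
   src to tgt is only a reference used to name the two endpoints of an edge. *)
Record graph := Graph {
  vert : finType;
  edge : finType;
  src : edge -> vert;
  tgt : edge -> vert;
  loopless : forall e, src e != tgt e }.

Section GraphDefs.
Variable G : graph.
Implicit Types (x y : vert G) (e : edge G) (A C T : {set edge G}).

Definition joins e x y : bool :=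
  ((src e == x) && (tgt e == y)) || ((src e == y) && (tgt e == x)).

Definition deg x : nat := #|[pred e : edge G | (src e == x) || (tgt e == x)]|.

(* An orientation o directs e from src e to tgt e if o e, and from tgt e to
   src e otherwise. *)
Definition arc (o : {ffun edge G -> bool}) : rel (vert G) := fun x y =>
  [exists e, if o e then (src e == x) && (tgt e == y)
             else (tgt e == x) && (src e == y)].

Definition acyclic_orientation (o : {ffun edge G -> bool}) : Prop :=
  ~ exists c : seq (vert G), c <> [::] /\ ucycle (arc o) c.

Definition alpha : nat :=
  #|[pred o : {ffun edge G -> bool} | `[< acyclic_orientation o >]]|.

Definition beta (R : realType) : R :=
  (\prod_(x : vert G) ((deg x)%:R + 1)) *
  \prod_(e : edge G)
     expR (- 1 / (2 * ((deg (src e))%:R + 1) * ((deg (tgt e))%:R + 1))).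

(* C is the edge set of a cycle vs_0 -es_0- vs_1 -es_1- ... -es_(k-1)- vs_0
   with distinct vertices and distinct edges (two parallel edges form a cycle
   with k = 2). *)
Definition is_cycle C : Prop :=
  exists (k : nat) (vs : 'I_k -> vert G) (es : 'I_k -> edge G),
    [/\ (0 < k)%N, injective vs, injective es,
        forall i, joins (es i) (vs i) (vs (ordS i))
      & forall e, e \in C <-> exists i, es i = e].

Definition spanning_connected A : Prop :=
  forall x y, connect (fun z w => [exists e in A, joins e z w]) x y.

Definition spanning_tree T : Prop :=
  spanning_connected T /\ (forall C, is_cycle C -> ~ (C \subset T)).

(* The unique cycle of T + e when T is a spanning tree and e \notin T. *)
Definition fund_cycle T e : {set edge G} :=
  xget finset.set0
    (fun C : {set edge G} => is_cycle C /\ C \subset (e |: T)%SET).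

(* The monomial x_1^(|C_1| - 2) ... x_k^(|C_k| - 2), where the i-th variable
   corresponds to the i-th edge outside of T. *)
Definition fund_monomial T : mpoly.multinom #|~: T| :=
  mpoly.Multinom
    [tuple (#|fund_cycle T (enum_val i)| - 2)%N | i < #|~: T|].

End GraphDefs.

(* The number of monomials of total degree d dividing m; all of them lie in the
   finite type of monomials of degree less than d + 1. *)
Definition num_divisors_deg (k : nat) (d : nat) (m : mpoly.multinom k) : nat :=
  #|[pred m' : mpoly.bmultinom k d.+1 |
      (mpoly.mdeg m' == d) && mpoly.lem m' m]|.

Definition gamma (G : graph) (T : {set edge G}) : nat :=
  (\sum_(d < #|vert G|)
     num_divisors_deg d (fund_monomial T) * 2 ^ (#|vert G| - d - 1))%N.

Section Theta.
Variables n t : nat.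

(* inl false and inl true are the vertices u and v; inr (i, j) is the internal
   vertex at distance j + 1 from u on the i-th path. *)
Definition theta_vert : finType := (bool + 'I_t * 'I_n.-1)%type.

(* The vertex at distance j from u on the i-th path, for j <= n. *)
Definition theta_pt (i : 'I_t) (j : nat) : theta_vert :=
  if j is j'.+1 then
    if insub j' is Some k then inr (i, k) else inl true
  else inl false.

Definition theta_src (e : 'I_t * 'I_n) : theta_vert := theta_pt e.1 e.2.
Definition theta_tgt (e : 'I_t * 'I_n) : theta_vert := theta_pt e.1 e.2.+1.

Lemma theta_loopless e : theta_src e != theta_tgt e.
Proof.
case: e => i [[|j] jn]; rewrite /theta_src /theta_tgt /=; first by case: insubP.
case: insubP => [k _ kj|]; last first.
  by rewrite -ltnS prednK ?jn // (leq_trans _ jn).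
case: insubP => [l _ lj|//]; apply/eqP => -[kl].
by move: lj; rewrite -kl kj => /n_Sn.
Qed.

End Theta.

Definition theta (n t : nat) : graph := Graph (@theta_loopless n t).

Lemma joinsC (G : graph) (e : edge G) x y : joins e x y = joins e y x.
Proof. by rewrite /joins orbC. Qed.

Lemma spanning_tree_exists (G : graph) :
  spanning_connected (finset.setTfor (edge G)) -> exists T : {set edge G}, spanning_tree T.
Proof.
move=> cG; pose P := [pred A : {set edge G} | `[< spanning_connected A >]].
have PT : P (finset.setTfor (edge G)) by apply/asboolP.
case: (arg_minnP (fun A : {set edge G} => #|A|) PT) => A /asboolP cA minA.
exists A; split=> // C [k [vs [es [k0 _ esI jn Ce]]]] sCA.
pose A' := (A :\ es (Ordinal k0))%SET.
set r := fun z w => [exists e in A', joins e z w].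
have rS : symmetric r by move=> z w; apply: eq_existsb => e; rewrite joinsC.
have cS : connect_sym r by apply: sym_connect_sym.
suff cA' : spanning_connected A'.
  have := minA A' (asboolT cA').
  rewrite (cardsD1 (es (Ordinal k0)) A).
  have -> : es (Ordinal k0) \in A.
    by apply: (fintype.subsetP sCA); apply/Ce; exists (Ordinal k0).
  by rewrite add1n ltnn.
have walk j (jk : (j < k)%N) : connect r (vs (ordS (Ordinal k0))) (vs (ordS (Ordinal jk))).
  elim: j jk => [|j IH] jk; first by rewrite (bool_irrelevance jk k0).
  have jk' := ltnW jk.
  apply: connect_trans (IH jk') _; apply: connect1.
  have E : ordS (Ordinal jk') = Ordinal jk by apply: val_inj; rewrite /= modn_small.
  rewrite E; apply/existsP; exists (es (Ordinal jk)); rewrite jn andbT /A' !inE.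
  apply/andP; split; first by apply/eqP => /esI.
  by apply: (fintype.subsetP sCA); apply/Ce; exists (Ordinal jk).
have lastk : (k.-1 < k)%N by rewrite prednK.
have := walk _ lastk.
have -> : ordS (Ordinal lastk) = Ordinal k0.
  by apply: val_inj; rewrite /= prednK // modnn.
move=> back x y.
have sub : subrel (fun z w => [exists e in A, joins e z w]) (connect r).
  move=> z w /existsP[e /andP[eA je]].
  case: (eqVneq e (es (Ordinal k0))) => [E|ne]; last first.
    by apply: connect1; apply/existsP; exists e; rewrite /A' !inE ne eA.
  have J := jn (Ordinal k0); move: je J back; rewrite E /joins.
  by move=> /orP[] /andP[/eqP <- /eqP <-] /orP[] /andP[/eqP <- /eqP <-] //;
     rewrite cS.
exact: (connect_sub sub) (cA x y).
Qed.

Lemma theta_connected n t : (0 < n)%N -> (0 < t)%N ->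
  spanning_connected (finset.setTfor (edge (theta n t))).
Proof.
move=> n0 t0; set r := fun z w => [exists e in finset.setTfor (edge (theta n t)), joins e z w].
have rS : symmetric r by move=> z w; apply: eq_existsb => e; rewrite joinsC.
have cS : connect_sym r by apply: sym_connect_sym.
have walk i j : (j <= n)%N -> connect r (inl false) (@theta_pt n t i j).
  elim: j => [|j IH] jn; first exact: connect0.
  apply: connect_trans (IH (ltnW jn)) (connect1 _).
  apply/existsP; exists (i, Ordinal jn); rewrite inE /joins /=.
  by rewrite /theta_src /theta_tgt /= !eqxx.
suff H z : connect r (inl false) z.
  by move=> x y; apply: connect_trans (H y); rewrite cS.
case: z => [[]|[i k]].
- suff -> : inl true = @theta_pt n t (Ordinal t0) n by exact: walk.
  by rewrite /theta_pt -[X in if X is _.+1 then _ else _](prednK n0) insubN ?ltnn.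
- exact: connect0.
- have := walk i k.+1; rewrite /theta_pt valK; apply.
  exact: leq_trans (ltn_ord k) (leq_pred n).
Qed.

Lemma theta_spanning_tree_exists n t : (0 < n)%N -> (0 < t)%N ->
  exists T : {set edge (theta n t)}, spanning_tree T.
Proof. by move=> *; apply/spanning_tree_exists/theta_connected. Qed.

(* Main.v *)
(** A spanning tree of [theta n t] contains exactly one of the [t] paths and misses one edge of
each other path, so there are [t - 1] fundamental cycles, all of length [2n]. Hence, with
[c = 2n - 2] and [p] vertices, [gamma / 2 ^ (p - 1)] is the expansion of
[(1 + 1/2 + ... + 1/2^c) ^ (t - 1)] without its terms of degree at least [p], and these
contribute at most [(c + 1) ^ (t - 1) / 2 ^ p].

For [t = 3] this gives [gamma ~ 4 * 2 ^ (3n - 2) = 2 ^ (3n)]. An orientation with a directed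
cycle has a path directed forwards and a path directed backwards, so all but [O(2 ^ n)] of the
[2 ^ (3n)] orientations are acyclic. For [n = 2] it gives [gamma >= 3 * (7/2) ^ (t - 1)], while
[beta <= (t + 1)^2 * 3 ^ t] because the exponential factors are at most [1]. *)

Require Import Defs.
From mathcomp Require Import all_boot all_order all_algebra.
From mathcomp Require Import (canonicals, coercions) mpoly.
From mathcomp Require Import boolp classical_sets reals topology normedtype.
From mathcomp Require Import sequences exp.
From mathcomp Require Import ring lra zify.

Set Implicit Arguments.
Unset Strict Implicit.
Unset Printing Implicit Defensive.

Import Order.TTheory GRing.Theory Num.Theory.
Import numFieldNormedType.Exports.

Local Open Scope ring_scope.

(** * Divisors of a monomial with equal exponents, and bounds on [gamma] *)

Lemma num_divisors_deg_const (k c d : nat) (m : mpoly.multinom k) :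
  (forall i, m i = c) ->
  num_divisors_deg d m =
  #|[pred f : {ffun 'I_k -> 'I_c.+1} | (\sum_i (f i : nat))%N == d]|.
Proof.
move=> mc; rewrite /num_divisors_deg.
(* A divisor has all exponents at most [c], so [inord] loses nothing on [P]. *)
pose g (m' : mpoly.bmultinom k d.+1) : {ffun 'I_k -> 'I_c.+1} :=
  [ffun i => inord (m' i)].
set P := [pred m' | _]; set Q := [pred f | _].
have gE m' : P m' -> forall i, g m' i = m' i :> nat.
  move=> /andP[_ /forallP m'm] i; rewrite ffunE inordK // ltnS.
  by have := m'm i; rewrite mc.
rewrite -(card_in_imset (f := g) (D := P)); last first.
  move=> m1 m2 P1 P2 g12; apply/val_inj/mpoly.mnmP => i.
  by rewrite -!gE // g12.
apply: eq_card => f; apply/imsetP/idP => [[m' Pm' ->]|/eqP fd].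
  rewrite inE (eq_bigr _ (fun i _ => gE m' Pm' i)) -mpoly.mdegE.
  by case/andP: Pm'.
pose m0 := mpoly.Multinom [tuple (f i : nat) | i < k].
have m0E i : m0 i = f i by rewrite mpoly.mnmE.
have dm0 : mpoly.mdeg m0 = d.
  by rewrite mpoly.mdegE -fd; apply: eq_bigr => i _; rewrite m0E.
have lt0 : (mpoly.mdeg m0 < d.+1)%N by rewrite dm0.
have Pm : P (mpoly.BMultinom lt0).
  rewrite /= dm0 eqxx /=; apply/forallP => i.
  by rewrite mc m0E -ltnS ltn_ord.
by exists (mpoly.BMultinom lt0) => //; apply/ffunP => i; apply/val_inj; rewrite /= gE // m0E.
Qed.

Section GammaBounds.
Variables (R : realType) (G : graph) (T : {set edge G}) (c : nat).
Hypothesis cycT : forall e, e \notin T -> (#|fund_cycle T e| - 2)%N = c.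

Let k := #|~: T|.
Let p := #|vert G|.
Let wt (f : {ffun 'I_k -> 'I_c.+1}) : nat := (\sum_i f i)%N.

(** Interchange of summation: each exponent vector [f] is counted once, in degree [wt f], provided
    that degree is below [p]. *)
Lemma gamma_sum_wt : gamma T = (\sum_(f | wt f < p) 2 ^ (p - wt f - 1))%N.
Proof.
rewrite /gamma -/p.
have cE i : fund_monomial T i = c.
  rewrite /fund_monomial mpoly.mnmE cycT //.
  by have := enum_valP i; rewrite inE.
transitivity (\sum_(d < p) \sum_(f | wt f == d) 2 ^ (p - d - 1))%N.
  apply: eq_bigr => d _.
  by rewrite (num_divisors_deg_const _ cE) sum_nat_const.
case: p => [|q]; first by rewrite big_ord0 big_pred0.
(* [inord] gives a junk degree when [wt f] is too large, but the condition of the sum excludes those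
   [f]. *)
rewrite [RHS](partition_big (fun f => inord (wt f) : 'I_q.+1) xpredT) //=.
apply: eq_bigr => d _; apply: congr_big => // f => [|/eqP->//].
case: (ltnP (wt f) q.+1) => [l|l] /=.
  by rewrite -[in RHS]val_eqE /= inordK.
by apply/eqP => E; move: l; rewrite E leqNgt ltn_ord.
Qed.

Lemma expr_geometric_half :
  (\sum_(j < c.+1) (2^-1 : R) ^+ j) ^+ k = \sum_f (2^-1 : R) ^+ wt f.
Proof.
rewrite -[in LHS](card_ord k) -prodr_const (bigA_distr_bigA (fun _ (j : 'I_c.+1) => (2^-1 : R) ^+ j)).
by apply: eq_bigr => f _; rewrite /wt expr_sum.
Qed.

Lemma gamma_scaled : (0 < p)%N ->
  (gamma T)%:R = 2 ^+ p.-1 * \sum_(f | (wt f < p)%N) (2^-1 : R) ^+ wt f.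
Proof.
move=> p0; rewrite gamma_sum_wt natr_sum mulr_sumr; apply: eq_bigr => f lf.
rewrite natrX exprVn -subnDA addn1 subnS.
have -> : p.-1 = ((p - wt f).-1 + wt f)%N by lia.
by rewrite exprD mulfK ?expf_neq0 ?pnatr_eq0 //; congr (_ ^+ _); lia.
Qed.

Lemma gamma_le : (0 < p)%N ->
  (gamma T)%:R <= 2 ^+ p.-1 * (\sum_(j < c.+1) (2^-1 : R) ^+ j) ^+ k.
Proof.
move=> p0; rewrite gamma_scaled // ler_wpM2l ?exprn_ge0 // expr_geometric_half.
rewrite [leRHS](bigID (fun f => (wt f < p)%N)) /= lerDl.
by apply: sumr_ge0 => f _; rewrite exprn_ge0 // invr_ge0.
Qed.

(** The full expansion exceeds [gamma] by the terms with [p <= wt f]. Scaled by 2^(p-1), each of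
    them is at most 1, and there are at most (c+1)^k of them. *)
Lemma gamma_ge : (0 < p)%N ->
  2 ^+ p.-1 * (\sum_(j < c.+1) (2^-1 : R) ^+ j) ^+ k - c.+1%:R ^+ k <=
  (gamma T)%:R.
Proof.
move=> p0; rewrite gamma_scaled // expr_geometric_half.
rewrite [X in 2 ^+ _ * X - _](bigID (fun f => (wt f < p)%N)) /= mulrDr -addrA gerDl subr_le0.
have -> : (c.+1%:R : R) ^+ k = \sum_(f : {ffun 'I_k -> 'I_c.+1}) 1.
  by rewrite sumr_const card_ffun !card_ord natrX.
rewrite [leRHS](bigID (fun f => (wt f < p)%N)) /= mulr_sumr ler_wpDl ?sumr_ge0 //.
apply: ler_sum => f; rewrite -leqNgt => pf.
rewrite exprVn ler_pdivrMr ?exprn_gt0 // mul1r ler_weXn2l ?ler1n //; lia.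
Qed.

End GammaBounds.

(** * Cycles and directed cycles in an arbitrary graph *)

Section Cycles.
Variable G : graph.
Implicit Types (x : vert G) (e : edge G) (C : {set edge G}).

Definition edge_at e x : bool := (src e == x) || (tgt e == x).

(** A common weakening of undirected cycles and of edge sets carrying a directed cycle: no vertex
    has degree one in [C]. In a theta graph this already forces [C] to consist of whole paths. *)
Definition leafless C : Prop := forall e x, e \in C -> edge_at e x ->
  exists e', [/\ e' \in C, e' != e & edge_at e' x].

Lemma is_cycle_neq0 C : is_cycle C -> exists e, e \in C.
Proof.
by move=> [k [vs [es [k0 _ _ _ Ce]]]]; exists (es (Ordinal k0)); apply/Ce; eexists.
Qed.

Lemma is_cycle_leafless C : is_cycle C -> leafless C.
Proof.
move=> [k [vs [es [k0 _ esI jn Ce]]]] e x /Ce[i <-{e}] ex.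
have inC j : es j \in C by apply/Ce; exists j.
have atl j : edge_at (es j) (vs j).
  by have := jn j; rewrite /joins /edge_at => /orP[]/andP[/eqP-> /eqP->]; rewrite eqxx ?orbT.
have atr j : edge_at (es j) (vs (ordS j)).
  by have := jn j; rewrite /joins /edge_at => /orP[]/andP[/eqP-> /eqP->]; rewrite eqxx ?orbT.
(* Equality would give [ordS j = j] by injectivity, making [es j] a loop; this rules out cycles of
   length 1. *)
have neS j : es (ordS j) != es j.
  apply/eqP => /esI E; have := jn j; rewrite E /joins orbb => /andP[/eqP s /eqP t].
  by have := loopless (es j); rewrite s t eqxx.
have : x = vs i \/ x = vs (ordS i).
  move: ex (jn i); rewrite /edge_at /joins.
  by move=> /orP[]/eqP-> /orP[]/andP[/eqP sE /eqP tE]; by [left; rewrite ?sE ?tE|right; rewrite ?sE ?tE].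
(* The second edge at [vs i] is the preceding one, and at [vs (ordS i)] the following one. *)
case=> ->.
  have := neS (ord_pred i); have := atr (ord_pred i); rewrite ord_predK eq_sym => ri nei.
  by exists (es (ord_pred i)); split.
by exists (es (ordS i)); split.
Qed.

Definition arc_tail (o : {ffun edge G -> bool}) e := if o e then src e else tgt e.
Definition arc_head (o : {ffun edge G -> bool}) e := if o e then tgt e else src e.

Lemma orientation_arcP (o : {ffun edge G -> bool}) x y :
  reflect (exists2 e, arc_tail o e = x & arc_head o e = y) (Defs.arc o x y).
Proof.
apply: (iffP existsP) => [[e]|[e <- <-]]; rewrite ?/arc_tail ?/arc_head.
  by case oe: (o e) => /andP[/eqP<- /eqP<-]; exists e; rewrite oe.
by exists e; case: (o e); rewrite !eqxx.
Qed.

Lemma cyclic_orientation_circulation (o : {ffun edge G -> bool}) :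
  ~ acyclic_orientation o -> exists C : {set edge G},
  (exists e, e \in C) /\ forall e x, e \in C -> edge_at e x ->
    (exists2 e1, e1 \in C & arc_head o e1 = x) /\
    (exists2 e2, e2 \in C & arc_tail o e2 = x).
Proof.
move=> /contrapT[c [c0 /andP[cyc uc]]].
(* A directed cycle lists vertices only, so [C] takes every arc from a vertex of [c] to its
   successor. Parallel arcs may make [C] larger than a cycle, hence the conclusion only speaks of an
   in-edge and an out-edge at each vertex. *)
pose C := [set e | (arc_tail o e \in c) && (arc_head o e == next c (arc_tail o e))]%SET.
have cout x : x \in c -> exists2 e2, e2 \in C & arc_tail o e2 = x.
  move=> xc; have /orientation_arcP[e ex ey] := next_cycle cyc xc.
  by exists e => //; rewrite inE ex ey xc eqxx.
have cin x : x \in c -> exists2 e1, e1 \in C & arc_head o e1 = x.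
  move=> xc; have /orientation_arcP[e ex ey] := prev_cycle cyc xc.
  by exists e => //; rewrite inE ex ey mem_prev xc next_prev ?eqxx.
exists C; split.
  case: c c0 {cyc uc} @C cout cin => // x c _ C cout _.
  by case: (cout x); rewrite ?mem_head // => e; exists e.
move=> e x; rewrite inE => /andP[tc /eqP he] ex.
suff xc : x \in c by split; [apply: cin|apply: cout].
have hc : arc_head o e \in c by rewrite he mem_next.
move: ex tc hc; rewrite /edge_at /arc_tail /arc_head.
by case: (o e) => /orP[]/eqP->.
Qed.

(** Without loops, the in-edge and the out-edge at [x] differ, so at least one of them is not
    [e]. *)
Lemma circulation_leafless (o : {ffun edge G -> bool}) C :
  (forall e x, e \in C -> edge_at e x ->
    (exists2 e1, e1 \in C & arc_head o e1 = x) /\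
    (exists2 e2, e2 \in C & arc_tail o e2 = x)) -> leafless C.
Proof.
move=> circ e x eC ex; have [[e1 e1C h1] [e2 e2C t2]] := circ e x eC ex.
have e12 : e1 != e2.
  apply/eqP => E; move: h1 t2; rewrite E /arc_head /arc_tail.
  by have := loopless e2; case: (o e2) => /eqP ne h1 t2; case: ne; rewrite h1 t2.
have [E|ne] := eqVneq e1 e; last first.
  exists e1; split=> //; rewrite -h1 /edge_at /arc_head.
  by case: (o e1); rewrite eqxx ?orbT.
exists e2; split=> //; first by rewrite -E eq_sym.
by rewrite -t2 /edge_at /arc_tail; case: (o e2); rewrite eqxx ?orbT.
Qed.

End Cycles.

(** * Leafless sets and directed cycles in theta graphs *)

Lemma ord_step_const (n : nat) (X : Type) (f : 'I_n -> X) :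
  (forall j j' : 'I_n, j' = j.+1 :> nat -> f j = f j') ->
  forall j j', f j = f j'.
Proof.
case: n f => [|n] f st; first by case.
suff H m : (m <= n)%N -> f (inord m) = f ord0.
  by move=> j j'; rewrite -(inord_val j) -(inord_val j') !H // -ltnS.
elim: m => [_|m IH mn]; first by congr f; apply: val_inj; rewrite /= inordK.
rewrite -(IH (ltnW mn)); apply/esym/st; rewrite !inordK //; lia.
Qed.

Section ThetaGraph.
Variables n t : nat.
Implicit Types (i : 'I_t) (j : 'I_n) (C : {set edge (theta n t)}).
Notation pt := (@theta_pt n t).

Lemma theta_pt_end i : (0 < n)%N -> pt i n = inl true.
Proof. by move=> n0; rewrite /theta_pt -[X in if X is _.+1 then _ else _](prednK n0) insubN ?ltnn. Qed.

Lemma theta_pt_inj i i' (a b : nat) : (a <= n)%N -> (b <= n)%N ->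
  pt i a = pt i' b -> a = b /\ ((0 < a < n)%N -> i = i').
Proof.
case: a b => [|a] [|b] an bn //=; first by case: insubP.
  by case: insubP.
case: insubP => [k _ ka|]; case: insubP => [l _ lb|].
- by move=> [<- kl]; rewrite -ka -lb kl.
- by [].
- by [].
by rewrite -!leqNgt => nb na _; split; lia.
Qed.

Lemma edge_at_pt i i' j (a : nat) : (a <= n)%N ->
  edge_at (G := theta n t) (i', j) (pt i a) ->
  ((0 < a < n)%N -> i' = i) /\ (a = j \/ a = j.+1).
Proof.
move=> an; have jn := ltn_ord j; rewrite /edge_at => /orP[]/eqP E.
  by have [<- H] := theta_pt_inj (ltnW jn) an E; split; [|left].
by have [<- H] := theta_pt_inj jn an E; split; [|right].
Qed.

Lemma edge_at_src i j : edge_at (G := theta n t) (i, j) (pt i j).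
Proof. by rewrite /edge_at /= /theta_src /= eqxx. Qed.

Lemma edge_at_tgt i j : edge_at (G := theta n t) (i, j) (pt i j.+1).
Proof. by rewrite /edge_at /= /theta_tgt /= eqxx orbT. Qed.

(** The inner vertex between two consecutive edges of a path meets no third edge. *)
Lemma leafless_path_step C i j j' : leafless C -> j' = j.+1 :> nat ->
  ((i, j) \in C) = ((i, j') \in C).
Proof.
move=> lC jj'; have j'n := ltn_ord j'.
have R1 : (0 < j' < n)%N by lia.
apply/idP/idP => eC.
  have := edge_at_tgt i j; rewrite -jj' => ex; have [[i1 j1] [e1C ne ex1]] := lC _ _ eC ex.
  have [|Ei [E|E]] := edge_at_pt _ ex1; first exact: ltnW.
    by rewrite -(Ei R1) (_ : j' = j1) //; apply: val_inj.
  by case/eqP: ne; rewrite Ei //; congr pair; apply/val_inj => /=; lia.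
have ex := edge_at_src i j'; have [[i1 j1] [e1C ne ex1]] := lC _ _ eC ex.
have [|Ei [E|E]] := edge_at_pt _ ex1; first exact: ltnW.
  by case/eqP: ne; rewrite Ei //; congr pair; apply/val_inj => /=; lia.
by rewrite -(Ei R1) (_ : j = j1) //; apply: val_inj; move: E; rewrite jj' => -[].
Qed.

Lemma leafless_path C i j j' : leafless C -> (i, j) \in C -> (i, j') \in C.
Proof.
move=> lC; rewrite (@ord_step_const n _ (fun j => (i, j) \in C) _ j j') // => a b.
exact: leafless_path_step.
Qed.

(** [C] contains the first edge of path [i]. Every edge at [u] is the first of its path, so a second
    edge of [C] at [u] starts a different path. *)
Lemma leafless_two_paths C i j : leafless C -> (i, j) \in C ->
  exists2 i', i' != i & forall j', (i', j') \in C.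
Proof.
move=> lC ijC; have n0 : (0 < n)%N by have := ltn_ord j; lia.
have e0 := leafless_path (Ordinal n0) lC ijC.
have [[i1 j1] [e1C ne ex]] := lC _ _ e0 (edge_at_src i (Ordinal n0)).
exists i1 => [|j']; last exact: leafless_path e1C.
have [|_ [E|E]] // := edge_at_pt _ ex.
by apply: contraNneq ne => ->; apply/eqP; congr pair; apply/val_inj => /=; rewrite -E.
Qed.

(** On a path contained in [C], each inner vertex has an in-edge and an out-edge in [C], so the
    direction never changes along the path. The out-edge of [C] at [u] then lies on a forward path
    and the in-edge on a backward one. *)
Lemma theta_cyclic_orientation (o : {ffun edge (theta n t) -> bool}) :
  ~ acyclic_orientation o ->
  exists i i', (forall j, o (i, j)) /\ (forall j, ~~ o (i', j)).
Proof.
move=> /cyclic_orientation_circulation[C [[[i j] eC] circ]].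
have lC := circulation_leafless circ.
have n0 : (0 < n)%N by have := ltn_ord j; lia.
have tailP (i1 : 'I_t) (j1 : 'I_n) (a : nat) i0 : (a <= n)%N ->
    arc_tail o (i1, j1) = pt i0 a -> a = (if o (i1, j1) then j1 : nat else j1.+1).
  move=> an; rewrite /arc_tail; have jn := ltn_ord j1.
  by case: ifP => _ /theta_pt_inj[] //=; rewrite ltnW.
have headP (i1 : 'I_t) (j1 : 'I_n) (a : nat) i0 : (a <= n)%N ->
    arc_head o (i1, j1) = pt i0 a -> a = (if o (i1, j1) then j1.+1 else j1 : nat).
  move=> an; rewrite /arc_head; have jn := ltn_ord j1.
  by case: ifP => _ /theta_pt_inj[] //=; rewrite ltnW.
(* Membership in [C] and direction are combined into one function, so that constancy along a path
   can be checked on consecutive edges. *)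
pose f i1 j1 := if (i1, j1) \in C then Some (o (i1, j1)) else None.
have fC i1 : forall j1 j2, f i1 j1 = f i1 j2.
  apply: ord_step_const => j1 j2 j12; have j2n := ltn_ord j2.
  rewrite /f -(leafless_path_step i1 lC j12); case: ifP => // e1C; congr Some.
  have [[[i3 j3] e3C h3] [[i4 j4] e4C t4]] := circ _ _ e1C (edge_at_tgt i1 j1).
  have at3 : edge_at (G := theta n t) (i3, j3) (pt i1 j1.+1).
    by rewrite -h3 /edge_at /arc_head; case: (o _); rewrite eqxx ?orbT.
  have at4 : edge_at (G := theta n t) (i4, j4) (pt i1 j1.+1).
    by rewrite -t4 /edge_at /arc_tail; case: (o _); rewrite eqxx ?orbT.
  have j1n : (j1.+1 <= n)%N by [].
  have := edge_at_pt j1n at3; have := edge_at_pt j1n at4.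
  have -> : (0 < j1.+1 < n)%N by lia.
  move=> [/(_ isT) E4 _] [/(_ isT) E3 _]; subst i3 i4.
  have := headP _ _ _ _ j1n h3; have := tailP _ _ _ _ j1n t4.
  have eqj (a b : 'I_n) : a = b :> nat -> a = b by apply: val_inj.
  (* The in-edge [j3] and the out-edge [j4] meet at distance [j1.+1]. If their directions agree,
     they are the edges [j1] and [j2]; otherwise the indices make them the same edge, with two
     directions. *)
  case o4: (o _) => j4E; case o3: (o _) => j3E.
  - have {}j3E : j3 = j1 by apply: eqj; lia.
    have {}j4E : j4 = j2 by apply: eqj; lia.
    by rewrite -j3E -j4E o3 o4.
  - have E : j3 = j4 by apply: eqj; lia.
    by move: o3; rewrite E o4.
  - have E : j3 = j4 by apply: eqj; lia.
    by move: o3; rewrite E o4.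
  - have {}j3E : j3 = j2 by apply: eqj; lia.
    have {}j4E : j4 = j1 by apply: eqj; lia.
    by rewrite -j3E -j4E o3 o4.
have const i1 j1 : (i1, j1) \in C -> forall j2, o (i1, j2) = o (i1, j1).
  move=> e1C j2; have := fC i1 j1 j2.
  by rewrite /f e1C (leafless_path j2 lC e1C) => -[].
have e0 := leafless_path (Ordinal n0) lC eC.
have [[[i3 j3] e3C h3] [[i4 j4] e4C t4]] := circ _ _ e0 (edge_at_src i (Ordinal n0)).
exists i4, i3; split=> j'.
  by rewrite (const _ _ e4C); have := tailP _ _ 0%N _ isT t4; case: (o _).
by rewrite (const _ _ e3C); have := headP _ _ 0%N _ isT h3; case: (o _).
Qed.

End ThetaGraph.

(** * Acyclic orientations of [theta n 3] *)

Lemma alpha_theta3_le n : (alpha (theta n 3) <= 2 ^ (3 * n))%N.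
Proof.
rewrite /alpha (leq_trans (max_card _)) // card_ffun card_bool.
by rewrite (_ : #|edge (theta n 3)| = (3 * n)%N) // card_prod !card_ord.
Qed.

(** A cyclic orientation is determined by its forward path, its backward path and its values on the
    third path, which leaves at most 3 * 3 * 2^n of them. *)
Lemma alpha_theta3_ge n : (2 ^ (3 * n) <= alpha (theta n 3) + 9 * 2 ^ n)%N.
Proof.
pose h (u : 'I_3 * 'I_3 * {ffun 'I_n -> bool}) : {ffun edge (theta n 3) -> bool} :=
  [ffun e : 'I_3 * 'I_n =>
     if e.1 == u.1.1 then true else if e.1 == u.1.2 then false else u.2 e.2].
pose A := [pred o : {ffun edge (theta n 3) -> bool} | `[< acyclic_orientation o >]].
have -> : (2 ^ (3 * n) = #|{: {ffun edge (theta n 3) -> bool}}|)%N.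
  by rewrite card_ffun card_bool /= card_prod !card_ord.
rewrite /alpha -(cardC A) leq_add2l.
have -> : (9 * 2 ^ n = #|{: 'I_3 * 'I_3 * {ffun 'I_n -> bool}}|)%N.
  by rewrite !card_prod card_ffun card_bool !card_ord.
apply: leq_trans (leq_imset_card h _); apply/subset_leq_card/fintype.subsetP => o.
rewrite !inE => /asboolPn /theta_cyclic_orientation[i [i' [oi oi']]].
(* As 0 + 1 + 2 = 3, the index of the third path is [3 - i - i']. *)
apply/imsetP; exists (i, i', [ffun j => o (inord (3 - i - i'), j)]) => //.
apply/ffunP => -[a j]; rewrite ffunE /=; case: (eqVneq a i) => [->|ai]; first by rewrite oi.
case: (eqVneq a i') => [->|ai']; first exact/negbTE.
rewrite ffunE (_ : inord _ = a) //; apply: val_inj.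
have ii' : i != i' by apply/eqP => E; have := oi' j; rewrite -E oi.
move: ai ai' ii'; rewrite -!val_eqE /= => ai ai' ii'.
have := ltn_ord a; have := ltn_ord i; have := ltn_ord i'.
by move=> *; rewrite inordK; lia.
Qed.

(** * Spanning trees and fundamental cycles of theta graphs *)

Section ThetaSpanningTree.
Variables (n t : nat).
Hypothesis n0 : (0 < n)%N.
Notation pt := (@theta_pt n t).
Implicit Types i : 'I_t.

Definition two_paths i i' : {set edge (theta n t)} :=
  [set e : 'I_t * 'I_n | (e.1 == i) || (e.1 == i')]%SET.

Lemma card_two_paths i i' : i != i' -> #|two_paths i i'| = (2 * n)%N.
Proof.
move=> ii'; have -> : two_paths i i' = finset.setX [set i; i']%SET (finset.setTfor 'I_n).
  by apply/finset.setP => -[a j]; rewrite !inE andbT.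
by rewrite cardsX cards2 ii' cardsT card_ord.
Qed.

Lemma is_cycle_two_paths i i' : i != i' -> is_cycle (two_paths i i').
Proof.
move=> ii'.
(* The cycle runs from [u] to [v] along path [i] and returns along [i']. On the way back, step [a]
   goes from distance [2 * n - a] to [2 * n - 1 - a], which is the index of its edge. *)
pose v (a : nat) := if (a < n)%N then pt i a else pt i' (2 * n - a).
have ltE (a : nat) : ((if (a < n)%N then a else 2 * n - 1 - a) < n)%N.
  by case: ifP; lia.
pose E (a : nat) : edge (theta n t) :=
  (if (a < n)%N then i else i', Ordinal (ltE a)).
exists (2 * n)%N, (fun a => v a), (fun a => E a); split.
- by lia.
- move=> a b; have := ltn_ord a; have := ltn_ord b; rewrite /v => bn an.
  case: ifP => an'; case: ifP => bn' /theta_pt_inj [||F H]; try lia;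
    apply: val_inj => /=; try lia.
  + have : i = i' by apply: H; lia.
    by move/eqP: ii'.
  + have : i' = i by apply: H; lia.
    by move/eqP: ii' => + E'; rewrite E'.
- move=> a b; have := ltn_ord a; have := ltn_ord b; rewrite /E => bn an [].
  case: ifP => an'; case: ifP => bn' F F'; apply: val_inj => /=; try lia.
  + by move/eqP: ii'; rewrite F.
  + by move/eqP: ii'; rewrite F.
- move=> a; have an := ltn_ord a.
  have vS : v (ordS a) = v a.+1.
    have [aS|aS] := ltnP a.+1 (2 * n); first by rewrite /= modn_small.
    have {}aS : a.+1 = (2 * n)%N by lia.
    by rewrite /= aS modnn /v n0 (_ : (2 * n < n)%N = false) ?subnn //; lia.
  rewrite vS /joins /= /theta_src /theta_tgt /E /v [_.1]/= [_.2]/=.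
  rewrite (_ : nat_of_ord (Ordinal (ltE a)) = if (a < n)%N then nat_of_ord a else 2 * n - 1 - a)%N //.
  have [aSn|aSn] := ltnP a.+1 n.
    by rewrite (ltnW aSn) !eqxx.
  have [an'|an'] := ltnP a n.
    have -> : a.+1 = n by lia.
    have -> : (2 * n - n = n)%N by lia.
    by rewrite !theta_pt_end // !eqxx.
  have -> : (2 * n - 1 - a = 2 * n - a.+1)%N by lia.
  have -> : ((2 * n - a.+1).+1 = 2 * n - a)%N by lia.
  by rewrite !eqxx orbT.
move=> [b j]; have jn := ltn_ord j; rewrite inE /=; split.
  move=> /orP[]/eqP->.
    have l : (j < 2 * n)%N by lia.
    exists (Ordinal l); rewrite /E /=; congr pair; first by rewrite jn.
    by apply: val_inj; rewrite /= jn.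
  have l : (2 * n - 1 - j < 2 * n)%N by lia.
  have l' : (2 * n - 1 - j < n)%N = false by lia.
  exists (Ordinal l); rewrite /E /=; congr pair; first by rewrite l'.
  by apply: val_inj; rewrite /= l'; lia.
by move=> [a [<- _]]; case: ifP; rewrite eqxx ?orbT.
Qed.

Variable T : {set edge (theta n t)}.
Hypothesis spT : spanning_tree T.

(** Connectivity in terms of cuts: a set of vertices crossed by no tree edge is empty or everything.
    The next two lemmas apply it to suitable sets [S]. *)
Lemma spanning_tree_closed (S : pred (vert (theta n t))) :
  (forall e, e \in T -> S (src e) = S (tgt e)) -> forall x y, S x = S y.
Proof.
move=> clS x y; have [cT _] := spT; apply: closed_connect (cT x y) => z w.
move=> /existsP[e /andP[eT]]; rewrite /joins !unfold_in.
by case/orP => /andP[/eqP<- /eqP<-]; rewrite clS.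
Qed.

(** Two missing edges on one path would cut off the vertices between them. *)
Lemma spanning_tree_path_miss i (j j' : 'I_n) :
  (i, j) \notin T -> (i, j') \notin T -> j = j'.
Proof.
wlog jj' : j j' / (j < j')%N => [H|].
  move=> jT j'T; case: (ltngtP j j') => [l|l|/val_inj//]; first exact: H.
  by apply/esym/H.
move=> jT j'T; exfalso; have j'n := ltn_ord j'.
(* [inr (b, k)] is at distance [k.+1], so [S] holds at the distances from [j.+1] to [j'] on path
   [i]. *)
pose S (x : vert (theta n t)) : bool :=
  if x is inr (b, k) then (b == i) && (j <= k < j')%N else false.
have Spt b a : (a <= n)%N -> S (pt b a) = (b == i) && (j < a <= j')%N.
  case: a => [|a] an /=; first by rewrite andbF.
  case: insubP => [k _ /= ->//|]; rewrite -leqNgt => na /=.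
  by case: eqP => //= _; lia.
have := @spanning_tree_closed S _ (pt i j.+1) (pt i 0).
rewrite !Spt // eqxx ltn0 ltnSn jj' /= => H; suff: true = false by [].
apply: H => -[b k] eT; have kn := ltn_ord k.
have kj : (b == i) -> k != j by move=> /eqP bi; apply: contraNneq jT => <-; rewrite -bi.
have kj' : (b == i) -> k != j' by move=> /eqP bi; apply: contraNneq j'T => <-; rewrite -bi.
rewrite /= /theta_src /theta_tgt !Spt //=; last exact: ltnW.
case: eqP kj kj' => //= _ /(_ isT) + /(_ isT); rewrite -!val_eqE /=; lia.
Qed.

Lemma spanning_tree_full_path : (0 < t)%N -> exists i, forall j, (i, j) \in T.
Proof.
move=> t0; apply/not_existsP => noi.
have /choice[f fT] : forall i, exists j, (i, j) \notin T.
  by move=> i; apply/not_existsP => H; apply: (noi i) => j; have /negP := H j; rewrite negbK.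
(* If each path [i] misses its edge [f i], the vertices on the side of [u] of these gaps form a set
   that separates [u] from [v]. *)
pose S (x : vert (theta n t)) : bool :=
  match x with inr (b, k) => (k < f b)%N | inl b => ~~ b end.
have Spt b a : (a <= n)%N -> S (pt b a) = (a <= f b)%N.
  case: a => [|a] an //=.
  case: insubP => [k _ /= ->//|]; rewrite -leqNgt => na /=.
  by have := ltn_ord (f b); lia.
suff: S (inl false) = S (inl true) by [].
apply: spanning_tree_closed => -[b k] eT; have kn := ltn_ord k.
rewrite /= /theta_src /theta_tgt !Spt //=; last exact: ltnW.
have : k != f b by apply: contraNneq (fT b) => <-.
by rewrite -val_eqE /=; lia.
Qed.

Lemma spanning_tree_full_path_uniq i i' :
  (forall j, (i, j) \in T) -> (forall j, (i', j) \in T) -> i = i'.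
Proof.
move=> iT i'T; apply/eqP/negP => /negP ii'.
have [_ /(_ _ (is_cycle_two_paths ii'))] := spT; apply.
by apply/fintype.subsetP => -[b j]; rewrite inE => /orP[]/eqP/= ->.
Qed.

(** Sending a missing edge to its path is injective, and its image is every path except the full
    one. *)
Lemma card_spanning_tree_compl : (0 < t)%N -> #|~: T| = t.-1.
Proof.
move=> t0; have [i iT] := spanning_tree_full_path t0.
rewrite -(card_in_imset (f := fst) (D := mem (~: T))); last first.
  move=> [a j] [b j']; rewrite !inE /= => aT + ab; rewrite -ab => bT.
  by congr pair; apply: spanning_tree_path_miss aT bT.
rewrite -[in RHS](card_ord t) -(cardsC1 i).
apply: eq_card => a; rewrite !inE; apply/imsetP/idP.
  by move=> [[b j]]; rewrite inE => bT ->; apply: contraNneq bT => /= ->.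
move=> ai; have : ~ forall j, (a, j) \in T.
  by move=> aT; case/eqP: ai; apply: spanning_tree_full_path_uniq.
by move/existsNP => [j /negP aj]; exists (a, j); rewrite ?inE.
Qed.

(** A cycle in T + e is a union of at least two whole paths, and only the full path of [T] and the
    path of [e] lie inside T + e. *)
Lemma card_fund_cycle_theta e : (0 < t)%N -> e \notin T -> #|fund_cycle T e| = (2 * n)%N.
Proof.
case: e => i1 j1 t0 eT; have [i iT] := spanning_tree_full_path t0.
have i1i : i1 != i by apply: contraNneq eT => ->.
rewrite /fund_cycle; case: xgetP => [C _ [cC sC]|].
  have lC := is_cycle_leafless cC.
  have fullC a : (forall j, (a, j) \in C) -> a = i1 \/ a = i.
    move=> aC; case: (eqVneq a i1) => [|ai1]; [by left|right].
    apply: spanning_tree_full_path_uniq => // j.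
    have := fintype.subsetP sC _ (aC j); rewrite !inE.
    by case/orP => // /eqP[E _]; rewrite E eqxx in ai1.
  suff -> : C = two_paths i1 i by apply: card_two_paths.
  have [[a j] aC] := is_cycle_neq0 cC.
  have aF j' : (a, j') \in C by apply: leafless_path aC.
  have [b ba bF] := leafless_two_paths lC aC.
  have [i1F iF] : (forall j', (i1, j') \in C) /\ (forall j', (i, j') \in C).
    by move: (aF) (bF) ba; case: (fullC a aF) (fullC b bF) => -> [] ->; rewrite ?eqxx.
  apply/finset.setP => -[d j']; rewrite inE /=; apply/idP/idP => [dC|].
    by case: (fullC d) => [j''|->|->]; rewrite ?eqxx ?orbT //; apply: leafless_path dC.
  by case/orP => /eqP->.
(* The default value of [xget] does not occur, as these two paths form a cycle in T + e. *)
move/(_ (two_paths i1 i)); case; split; first exact: is_cycle_two_paths.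
apply/fintype.subsetP => -[b j]; rewrite !inE /= => /orP[]/eqP-> //; last by rewrite iT orbT.
case: (boolP ((i1, j) \in T)) => [|jT]; first by rewrite orbT.
by rewrite (spanning_tree_path_miss jT eT) eqxx.
Qed.

End ThetaSpanningTree.

(** * Degrees in theta graphs and the bound on [beta] *)

Lemma card_theta_vert n t : #|vert (theta n t)| = (2 + t * n.-1)%N.
Proof. by rewrite card_sum card_bool card_prod !card_ord. Qed.

Lemma deg_theta_end n t (b : bool) : (0 < n)%N -> (deg (G := theta n t) (inl b) <= t)%N.
Proof.
move=> n0; pose f (e : edge (theta n t)) : 'I_t := e.1.
rewrite /deg -(card_in_imset (f := f)); first by rewrite -[leqRHS]card_ord max_card.
have H (i : 'I_t) (j : 'I_n) : edge_at (G := theta n t) (i, j) (inl b) ->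
    j = (if b then n.-1 else 0%N) :> nat.
  have -> : inl b = @theta_pt n t i (if b then n else 0).
    by case: b; rewrite ?theta_pt_end.
  move=> /edge_at_pt[|_]; first by case: b.
  by have := ltn_ord j; case: b; lia.
move=> [i j] [i' j']; rewrite !inE => /H je /H je'; rewrite /f /= => ->.
by congr pair; apply: val_inj; rewrite /= je je'.
Qed.

(** An inner vertex meets only edges of its own path. The bound is crude for large [n] but exact for
    [n = 2], where it is applied. *)
Lemma deg_theta_inner n t (u : 'I_t * 'I_n.-1) : (deg (G := theta n t) (inr u) <= n)%N.
Proof.
case: u => i k; pose f (e : edge (theta n t)) : 'I_n := e.2.
rewrite /deg -(card_in_imset (f := f)); first by rewrite -[leqRHS]card_ord max_card.
have H (i' : 'I_t) (j : 'I_n) : edge_at (G := theta n t) (i', j) (inr (i, k)) -> i' = i.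
  have kn := ltn_ord k; have -> : inr (i, k) = @theta_pt n t i k.+1 by rewrite /= valK.
  by move=> /edge_at_pt[|+ _]; [lia|apply; lia].
by move=> [i1 j1] [i2 j2]; rewrite !inE => /H -> /H ->; rewrite /f /= => ->.
Qed.

Lemma beta_ge0 (R : realType) G : 0 <= beta G R.
Proof.
apply: mulr_ge0; apply: prodr_ge0 => x _; last exact: expR_ge0.
by rewrite addr_ge0.
Qed.

Lemma beta_theta2_le (R : realType) t :
  beta (theta 2 t) R <= (t%:R + 1) ^+ 2 * 3 ^+ t.
Proof.
rewrite /beta -[leRHS]mulr1; apply: ler_pM.
- by apply: prodr_ge0 => x _; rewrite addr_ge0.
- by apply: prodr_ge0 => e _; apply: expR_ge0.
- rewrite big_sumType big_bool /= expr2 ler_pM ?mulr_ge0 ?addr_ge0 //.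
  + by apply: prodr_ge0 => x _; rewrite addr_ge0.
  + by rewrite ler_pM ?addr_ge0 // lerD2r ler_nat deg_theta_end.
  + have -> : (3 : R) ^+ t = \prod_(u : 'I_t * 'I_1) 3.
      by rewrite prodr_const card_prod !card_ord muln1.
    apply: ler_prod => u _; rewrite addr_ge0 //=.
    have := @deg_theta_inner 2 t u; rewrite -(ler_nat R); lra.
apply: prodr_ile1 => e _; rewrite expR_ge0 /= mulN1r -[leRHS]expR0 ler_expR oppr_le0.
by rewrite invr_ge0 !mulr_ge0 ?addr_ge0.
Qed.

(** * Numerical estimates of [gamma] and of the two ratios *)

Lemma gamma_theta2_ge (R : realType) s (T : {set edge (theta 2 s.+1)}) :
  spanning_tree T -> 3 * (7 / 2) ^+ s <= (gamma T)%:R :> R.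
Proof.
move=> sT; have cT e : e \notin T -> (#|fund_cycle T e| - 2)%N = 2%N.
  by move=> eT; rewrite card_fund_cycle_theta.
(* Here p - 1 = s + 2 and 1 + 1/2 + 1/4 = 7/4, so the lower bound is 4 * (7/2)^s - 3^s, and the
   subtracted power costs at most one (7/2)^s. *)
have := gamma_ge R cT; rewrite card_theta_vert card_spanning_tree_compl //= => /(_ isT).
apply: le_trans; rewrite muln1 add1n !big_ord_recl big_ord0 /= !expr0.
have -> : (1 + ((2^-1) ^+ bump 0 0 + ((2^-1) ^+ bump 0 (bump 0 0) + 0)) : R) = 7 / 4.
  by rewrite /bump /= expr1 expr2; lra.
have -> : (2 : R) ^+ s.+2 * (7 / 4) ^+ s = 4 * (7 / 2) ^+ s.
  rewrite !exprS (_ : 7 / 2 = 2 * (7 / 4)); last lra.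
  by rewrite [in RHS]exprMn; set a := (7 / 4) ^+ s; set b := 2 ^+ s; ring.
have : (3 : R) ^+ s <= (7 / 2) ^+ s by rewrite lerXn2r ?nnegrE //; lra.
lra.
Qed.

Lemma bernoulli_21_20 (R : realType) s : 1 + s%:R / 20 <= (21 / 20 : R) ^+ s.
Proof.
elim: s => [|s IH]; first by rewrite expr0 mul0r addr0.
rewrite exprS -natr1; have s0 : 0 <= s%:R :> R by [].
lra.
Qed.

(* (21/20)^3 < 7/6 turns Bernoulli's linear bound into a cubic one. *)
Lemma cube_le_expr (R : realType) s :
  (s%:R + 2) ^+ 3 <= 40 ^+ 3 * (7 / 6 : R) ^+ s.
Proof.
have s0 : 0 <= s%:R :> R by [].
(* The denominator 40 is generous: already (s + 2)/40 <= 1 + s/20. *)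
have H : (s%:R + 2) / 40 <= (21 / 20 : R) ^+ s.
  by apply: le_trans (bernoulli_21_20 R s); lra.
have H3 : ((s%:R + 2) / 40) ^+ 3 <= ((21 / 20 : R) ^+ s) ^+ 3.
  by rewrite lerXn2r ?nnegrE ?exprn_ge0 //; lra.
have : ((21 / 20 : R) ^+ s) ^+ 3 <= (7 / 6) ^+ s.
  by rewrite exprAC; apply: lerXn2r; rewrite ?nnegrE ?exprn_ge0 //; lra.
move: H3; rewrite exprMn exprVn => H3 H4.
by have := le_trans H3 H4; rewrite ler_pdivrMr ?exprn_gt0 // mulrC.
Qed.

Lemma sum_half_exp (R : realType) m :
  \sum_(j < m.+1) (2^-1 : R) ^+ j = 2 - (2^-1) ^+ m.
Proof.
elim: m => [|m IH]; first by rewrite big_ord1 !expr0; lra.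
by rewrite big_ord_recr /= IH exprS; lra.
Qed.

(** With y = 2^n, the full expansion is (y^3 / 4) * (2 - 4/y^2)^2 = y^3 - 4y + 4/y, and the
    truncation error (2n - 1)^2 is at most 4y^2. *)
Lemma gamma_theta3_bounds (R : realType) n (T : {set edge (theta n 3)}) :
  (0 < n)%N -> spanning_tree T ->
  (2 ^+ n) ^+ 3 - 8 * (2 ^+ n) ^+ 2 <= ((gamma T)%:R : R) <= (2 ^+ n) ^+ 3.
Proof.
(* From here on the path length is [n.+1], so [c = 2 * n] and p - 1 = 3n + 1. *)
case: n T => // n T _ sT; set y : R := 2 ^+ n.+1.
have cT e : e \notin T -> (#|fund_cycle T e| - 2)%N = (2 * n)%N.
  by move=> eT; rewrite card_fund_cycle_theta // mulnS addKn.
have := gamma_ge R cT; have := gamma_le R cT.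
rewrite card_theta_vert card_spanning_tree_compl // sum_half_exp /= add1n.
move=> /(_ isT) le /(_ isT) ge.
have y1 : 1 <= y by rewrite exprn_ege1 // ler1n.
have y2 : (2 : R) ^+ n = y / 2 by rewrite /y exprS [2 * _]mulrC mulfK ?pnatr_eq0.
have yE : (2 : R) ^+ (3 * n).+1 = y ^+ 3 / 4.
  by rewrite exprS mulnC exprM y2; field.
have y0 : y != 0 by rewrite gt_eqF // (lt_le_trans ltr01).
have xE : (2^-1 : R) ^+ (2 * n) = 4 / y ^+ 2.
  by rewrite exprVn mulnC exprM y2; field.
rewrite yE xE in le ge.
have ny : (2 * n).+1%:R <= 2 * y.
  rewrite /y -natrX -natrM ler_nat; have := ltn_expl n.+1 (isT : 1 < 2)%N; lia.
have ny2 : ((2 * n).+1%:R) ^+ 2 <= (2 * y) ^+ 2 by rewrite lerXn2r ?nnegrE // mulr_ge0 //; lra.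
apply/andP; split.
  apply: le_trans ge.
  have -> : y ^+ 3 / 4 * (2 - 4 / y ^+ 2) ^+ 2 = y ^+ 3 - 4 * y + 4 / y by field.
  have : 0 <= 4 / y by rewrite divr_ge0 //; lra.
  have : y <= y ^+ 2 by rewrite expr2 ler_peMl //; lra.
  by move: ny2; rewrite exprMn (_ : 2 ^+ 2 = 4 :> R); [lra|rewrite expr2; lra].
apply: le_trans le _.
have z2 : 4 / y ^+ 2 <= 4.
  have y2_1 : 1 <= y ^+ 2 by rewrite exprn_ege1.
  by rewrite ler_pdivrMr; lra.
have z0 : 0 <= 4 / y ^+ 2 by rewrite divr_ge0 ?exprn_ge0 //; lra.
have z4 : (2 - 4 / y ^+ 2) ^+ 2 <= 4 by rewrite expr2; nra.
have y3 : 0 <= y ^+ 3 by rewrite exprn_ge0 //; lra.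
nra.
Qed.

(** With y = 2^n, the defect 9y of [alpha] is weakened to 9y^2 so that the upper bound is a simple
    function of 1/y. The condition on [n] gives y >= 16, which keeps 1 - 9/y positive. *)
Lemma gamma_alpha_ratio_bounds (R : realType) n (T : {set edge (theta n 3)}) :
  (3 < n)%N -> spanning_tree T ->
  1 - 8 * 2^-1 ^+ n <= ((gamma T)%:R / (alpha (theta n 3))%:R : R) <= (1 - 9 * 2^-1 ^+ n)^-1.
Proof.
move=> n3 sT; have n0 : (0 < n)%N by lia.
have := gamma_theta3_bounds R n0 sT.
have := alpha_theta3_le n; have := alpha_theta3_ge n.
rewrite -!(ler_nat R) natrD natrM !natrX mulnC exprM exprVn.
have y16 : 16 <= 2 ^+ n :> R.
  have -> : n = (4 + (n - 4))%N by lia.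
  rewrite exprD (_ : 2 ^+ 4 = 16); last by rewrite -natrX.
  by rewrite ler_peMr // exprn_ege1 // ler1n.
set y : R := 2 ^+ n in y16 *; set a : R := (alpha _)%:R; set g : R := (gamma T)%:R.
move=> age ale /andP[gge gle].
have y2 : 16 * y <= y ^+ 2 by rewrite expr2; nra.
have y3 : 16 * y ^+ 2 <= y ^+ 3 by rewrite [y ^+ 3]exprSr mulrC; nra.
have a0 : 0 < a by lra.
have yn0 : y != 0 by rewrite gt_eqF //; lra.
apply/andP; split.
  have -> : 1 - 8 * y^-1 = (y ^+ 3 - 8 * y ^+ 2) / y ^+ 3 by field.
  have y30 : 0 < y ^+ 3 by lra.
  by rewrite ler_pM ?invr_ge0 ?lef_pV2 ?posrE //; lra.
have -> : (1 - 9 * y^-1)^-1 = y ^+ 3 / (y ^+ 3 - 9 * y ^+ 2).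
  by field; rewrite yn0 gt_eqF //; nra.
have d0 : 0 < y ^+ 3 - 9 * y ^+ 2 by lra.
by rewrite ler_pM ?invr_ge0 ?lef_pV2 ?posrE /g //; lra.
Qed.

(** For t = s + 1 the ratio is at most (s + 2)^2 / (7/6)^s. A cubic lower bound on (7/6)^s leaves a
    spare factor 1/(s + 2), which is [harmonic t]. *)
Lemma beta_gamma_ratio_le (R : realType) t (T : {set edge (theta 2 t)}) :
  (0 < t)%N -> spanning_tree T ->
  beta (theta 2 t) R / (gamma T)%:R <= 40 ^+ 3 * harmonic t.
Proof.
case: t T => // s T _ sT.
have G := gamma_theta2_ge R sT; have B := beta_theta2_le R s.+1.
have c := cube_le_expr R s.
have s0 : 0 < s%:R + 2 :> R by rewrite ltr_wpDl.
have q0 : 0 < (7 / 2 : R) ^+ s by rewrite exprn_gt0 //; lra.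
rewrite /harmonic /= ler_pdivrMr; last by lra.
rewrite -mulrA mulrCA -ler_pdivrMl ?invr_gt0 // invrK.
have -> : s.+2%:R = s%:R + 2 :> R by rewrite -addn2 natrD.
apply: (@le_trans _ _ ((s%:R + 2) * ((s%:R + 2) ^+ 2 * 3 ^+ s.+1))).
  rewrite ler_pM2l //; apply: le_trans B _.
  by rewrite -natr1 -addrA (_ : 1 + 1 = 2 :> R).
apply: (@le_trans _ _ (40 ^+ 3 * (3 * (7 / 2) ^+ s))); last first.
  by rewrite ler_wpM2l ?exprn_ge0.
rewrite mulrA -exprS (_ : 7 / 2 = 3 * (7 / 6)); last lra.
rewrite [(3 * (7 / 6)) ^+ s]exprMn [3 * _]mulrA -exprS [3 ^+ _ * _]mulrC mulrA.
by rewrite ler_wpM2r ?exprn_ge0.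
Qed.

(** * Both limits by squeezing *)

Local Open Scope classical_set_scope.

Theorem theorem5p3 (R : realType) :
  (forall T : forall n : nat, {set edge (theta n 3)},
     (forall n : nat, (0 < n)%N -> spanning_tree (T n)) ->
     (((gamma (T n))%:R / (alpha (theta n 3))%:R : R) @[n --> \oo] --> (1 : R)))
  /\
  (forall T : forall t : nat, {set edge (theta 2 t)},
     (forall t : nat, (0 < t)%N -> spanning_tree (T t)) ->
     ((beta (theta 2 t) R / (gamma (T t))%:R : R) @[t --> \oo] --> (0 : R))).
Proof.
split=> T sT.
  have x0 : (2^-1 : R) ^+ n @[n --> \oo] --> 0.
    by apply: cvg_expr; rewrite ger0_norm; lra.
  apply: (@squeeze_cvgr _ _ _ _ (fun n => 1 - 8 * 2^-1 ^+ n) (fun n => (1 - 9 * 2^-1 ^+ n)^-1)).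
  - exists 4%N => // n /= n4; apply: gamma_alpha_ratio_bounds => //.
    by apply: sT; lia.
  - rewrite -[X in _ --> X](_ : 1 - 8 * 0 = 1); last lra.
    by apply: cvgB; [exact: cvg_cst|apply: cvgMr].
  - rewrite -[X in _ --> X](_ : (1 - 9 * 0)^-1 = 1); last by rewrite mulr0 subr0 invr1.
    apply: cvgV; first by rewrite mulr0 subr0 oner_neq0.
    by apply: cvgB; [exact: cvg_cst|apply: cvgMr].
apply: (@squeeze_cvgr _ _ _ _ (fun _ => 0) (fun t => 40 ^+ 3 * harmonic t)).
- exists 1%N => // t /= t1; rewrite divr_ge0 ?beta_ge0 //=.
  by apply: beta_gamma_ratio_le => //; apply: sT.
- exact: cvg_cst.
- rewrite -[X in _ --> X](mulr0 (40 ^+ 3)); apply: cvgMr; exact: cvg_harmonic.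
Qed.
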